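(* Let $A$ be a residuated lattice. The following are equivalent: (1) $A$ is maximal and has the Boolean Lifting Property (BLP); (2) $A$ is maximal and $\mathrm{Rad}(A)$ has BLP; (3) $A$ is isomorphic to a finite direct product of local maximal residuated lattices.
   Context: A residuated lattice is a commutative integral bounded one: a structure $(A,\vee ,\wedge ,\odot ,\rightarrow ,0,1)$ such that $(A,\vee ,\wedge ,0,1)$ is a bounded lattice, $(A,\odot ,1)$ is a commutative monoid, and $a\leq b\rightarrow c$ iff $a\odot b\leq c$ for all $a,b,c\in A$. Write $a\leftrightarrow b=(a\rightarrow b)\wedge (b\rightarrow a)$. $\mathcal{B}(A)$ is the set of complemented elements of the bounded lattice reduct of $A$. A filter of $A$ is a nonempty subset closed under $\odot$ and upward closed. A maximal filter is a maximal element, under inclusion, of the set of filters different from $A$; $\mathrm{Rad}(A)$ is the intersection of all maximal filters (equal to $A$ if $A$ has only one element). $A$ is local iff it has exactly one maximal filter. For a filter $F$, $A/F$ is the quotient residuated lattice by the congruence $a\equiv b$ iff $a\leftrightarrow b\in F$, with classes $a/F$. $F$ has BLP iff for every $f\in \mathcal{B}(A/F)$ there is $e\in \mathcal{B}(A)$ with $e/F=f$. $A$ has BLP iff all its filters have BLP. $A$ is a maximal residuated lattice iff, for any index set $I$, any family $(a_i)_{i\in I}$ of elements of $A$ and any family $(F_i)_{i\in I}$ of filters of $A$ such that for every finite subset $J\subseteq I$ there exists $x_J\in A$ with $x_J/F_i=a_i/F_i$ for all $i\in J$, there exists $x\in A$ with $x/F_i=a_i/F_i$ for all $i\in I$. 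*)

(* Defs.v *)
From HB Require Import structures.
#[warnings="-notation-overridden"]
From mathcomp Require Import all_boot all_order.
From mathcomp Require Import generic_quotient.
From mathcomp Require Import boolp classical_sets cardinality.

Set Implicit Arguments.
Unset Strict Implicit.
Unset Printing Implicit Defensive.
Set Warnings "-redundant-canonical-projection".

Import Order.TTheory.
Local Open Scope classical_set_scope.
Local Open Scope quotient_scope.
Local Open Scope order_scope.

Declare Scope rl_scope.
Delimit Scope rl_scope with RL.
Local Open Scope rl_scope.

Reserved Notation "x \odot y" (at level 40, left associativity).
Reserved Notation "x \imp y" (at level 55, right associativity).
Reserved Notation "x \eqv y" (at level 56, no associativity).

(* Integrality is built in: the unit of the monoid is the top of the lattice.
   The one-element lattice is allowed (\bot = \top is not excluded). *)
HB.mixin Record isResiduated d A of Order.TBLattice d A := {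
  rlmul : A -> A -> A;
  rlimp : A -> A -> A;
  rlmulA : associative rlmul;
  rlmulC : commutative rlmul;
  rlmul1x : left_id (\top : A) rlmul;
  rl_residuation : forall a b c : A, (a <= rlimp b c) = (rlmul a b <= c)
}.

#[short(type="residuatedLatticeType")]
HB.structure Definition ResiduatedLattice d :=
  { A of Order.TBLattice d A & isResiduated d A }.

Notation "x \odot y" := (rlmul x y) : rl_scope.
Notation "x \imp y" := (rlimp x y) : rl_scope.
Notation "x \eqv y" := ((x \imp y) `&` (y \imp x))%O : rl_scope.

Section ResiduatedLatticeTheory.
Context {d : Order.disp_t} {A : residuatedLatticeType d}.
Implicit Types a b c x y z : A.

Lemma rlmulx1 a : a \odot \top = a.
Proof. by rewrite rlmulC rlmul1x. Qed.

Lemma rlmulACA a b c e : a \odot b \odot (c \odot e) = a \odot c \odot (b \odot e).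
Proof.
by rewrite -!rlmulA; congr (_ \odot _); rewrite !rlmulA [b \odot c]rlmulC.
Qed.

Lemma rl_mulimp a b : a \odot (a \imp b) <= b.
Proof. by rewrite rlmulC -rl_residuation. Qed.

Lemma rl_mul_mono a b c e : a <= b -> c <= e -> a \odot c <= b \odot e.
Proof.
have monol x y z : x <= y -> x \odot z <= y \odot z.
  by move=> xy; rewrite -rl_residuation (le_trans xy)// rl_residuation.
by move=> ab ce; rewrite (le_trans (monol _ _ c ab))// ![b \odot _]rlmulC monol.
Qed.

Lemma rl_imp_top a b : (a \imp b == \top) = (a <= b).
Proof. by rewrite -le1x rl_residuation rlmul1x. Qed.

Lemma rl_impxx a : a \imp a = \top.
Proof. by apply/eqP; rewrite rl_imp_top. Qed.

Lemma rl_imp_trans a b c : (a \imp b) \odot (b \imp c) <= a \imp c.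
Proof.
rewrite rl_residuation rlmulC rlmulA.
apply: le_trans (rl_mulimp b c).
exact: rl_mul_mono (rl_mulimp a b) (lexx _).
Qed.

Lemma rl_mul_leI a b : a \odot b <= a `&` b.
Proof.
rewrite lexI -{2}[a]rlmulx1 -{3}[b]rlmul1x.
by rewrite !rl_mul_mono// lex1.
Qed.

Lemma rl_imp_mono a b c e : c <= a -> b <= e -> a \imp b <= c \imp e.
Proof.
move=> ca be; rewrite rl_residuation.
apply: le_trans be; apply: le_trans (rl_mulimp a b).
by rewrite rlmulC rl_mul_mono.
Qed.

Lemma rl_imp_mul a b c : a \imp (b \imp c) = a \odot b \imp c.
Proof.
apply/le_anti/andP; split.
- by rewrite rl_residuation rlmulA -!rl_residuation.
- by rewrite !rl_residuation -rlmulA -rl_residuation.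
Qed.

End ResiduatedLatticeTheory.

Section Filters.
Context {d : Order.disp_t} (A : residuatedLatticeType d).

Definition is_filter (F : set A) : Prop :=
  [/\ F !=set0,
      forall a b, F a -> F b -> F (a \odot b)
    & forall a b, a <= b -> F a -> F b].

Record rlfilter := RLFilter {
  rlfilter_set :> A -> Prop;
  rlfilterP : is_filter rlfilter_set }.

Definition proper_filter (F : set A) : Prop := is_filter F /\ F <> setT.

Definition maximal_filter (M : set A) : Prop :=
  proper_filter M /\ forall F, proper_filter F -> M `<=` F -> F = M.

(* In the one-element residuated lattice there is no maximal filter and the
   intersection is the whole lattice. *)
Definition Rad_set : set A := \bigcap_(M in maximal_filter) M.

Definition is_local : Prop := exists! M : set A, maximal_filter M.

End Filters.

Arguments Rad_set {d} A _.

Section FilterTheory.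
Context {d : Order.disp_t} {A : residuatedLatticeType d}.
Implicit Types F : rlfilter A.

Lemma filter_up F a b : a <= b -> F a -> F b.
Proof. by case: (rlfilterP F) => _ _; apply. Qed.

Lemma filter_mul F a b : F a -> F b -> F (a \odot b).
Proof. by case: (rlfilterP F) => _ + _; apply. Qed.

Lemma filter_top F : F \top.
Proof. by case: (rlfilterP F) => -[a Fa] _ Fup; exact: Fup (lex1 a) Fa. Qed.

Lemma filterI F a b : F a -> F b -> F (a `&` b)%O.
Proof. by move=> Fa Fb; apply: filter_up (rl_mul_leI a b) (filter_mul Fa Fb). Qed.

Lemma filter_le F a b : a <= b -> F (a \imp b).
Proof. by rewrite -rl_imp_top => /eqP ->; exact: filter_top. Qed.

Lemma filter_imp_trans F a b c : F (a \imp b) -> F (b \imp c) -> F (a \imp c).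
Proof. by move=> Fab Fbc; apply: filter_up (rl_imp_trans a b c) (filter_mul Fab Fbc). Qed.

Lemma filter_eqv F a b : F (a \eqv b) <-> F (a \imp b) /\ F (b \imp a).
Proof.
split=> [Fab|[]]; last exact: filterI.
by split; apply: filter_up Fab; rewrite (leIl, leIr).
Qed.

End FilterTheory.

Lemma Rad_filter d (A : residuatedLatticeType d) : is_filter (Rad_set A).
Proof.
split=> [|a b Ra Rb M Mmax|a b ab Ra M Mmax].
- by exists \top => M [[Mfil _] _]; exact: (filter_top (RLFilter Mfil)).
- have [[[_ Mmul _] _] _] := Mmax; exact: Mmul (Ra M Mmax) (Rb M Mmax).
- have [[[_ _ Mup] _] _] := Mmax; exact: Mup ab (Ra M Mmax).
Qed.

Definition Rad d (A : residuatedLatticeType d) : rlfilter A :=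
  RLFilter (Rad_filter A).

Section Quotient.
Context {d : Order.disp_t} {A : residuatedLatticeType d}.
Variable F : rlfilter A.

Definition filter_eqv_rel : rel A := fun a b => `[< F (a \eqv b) >].

Lemma filter_eqv_rel_equiv : equiv_class_of filter_eqv_rel.
Proof.
split=> [a|a b|b a c].
- by apply/asboolP/filter_eqv; rewrite rl_impxx; split; exact: filter_top.
- by rewrite /filter_eqv_rel meetC.
- move=> /asboolP/filter_eqv[Fab Fba] /asboolP/filter_eqv[Fbc Fcb].
  by apply/asboolP/filter_eqv; split; [exact: filter_imp_trans Fab Fbc
                                      |exact: filter_imp_trans Fcb Fba].
Qed.

Canonical filter_equiv_rel := EquivRelPack filter_eqv_rel_equiv.

Definition rlquotient : Type := {eq_quot filter_equiv_rel}.

HB.instance Definition _ : EqQuotient A filter_equiv_rel rlquotient :=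
  EqQuotient.on rlquotient.
HB.instance Definition _ := Choice.on rlquotient.

Local Notation Q := rlquotient.

Lemma pi_eqv a b : (\pi_Q a = \pi_Q b) <-> F (a \eqv b).
Proof. by split=> [/eqP|ab]; [rewrite eqmodE => /asboolP|apply/eqmodP/asboolP]. Qed.

Lemma pi_eq a b : (\pi_Q a = \pi_Q b) <-> F (a \imp b) /\ F (b \imp a).
Proof. by rewrite pi_eqv filter_eqv. Qed.

Lemma repr_imp a : F (repr (\pi_Q a) \imp a) /\ F (a \imp repr (\pi_Q a)).
Proof. by apply/pi_eq; rewrite reprK. Qed.

Definition qle (x y : Q) : bool := `[< F (repr x \imp repr y) >].
Definition qmeet : Q -> Q -> Q := lift_op2 Q (@Order.meet d A).
Definition qjoin : Q -> Q -> Q := lift_op2 Q (@Order.join d A).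
Definition qmul : Q -> Q -> Q := lift_op2 Q (@rlmul d A).
Definition qimp : Q -> Q -> Q := lift_op2 Q (@rlimp d A).

Lemma qleE a b : qle (\pi_Q a) (\pi_Q b) = `[< F (a \imp b) >].
Proof.
have [a1 a2] := repr_imp a; have [b1 b2] := repr_imp b.
apply: asbool_equiv_eq; split=> h.
- exact: filter_imp_trans (filter_imp_trans a2 h) b1.
- exact: filter_imp_trans (filter_imp_trans a1 h) b2.
Qed.

Let lift2E (op : A -> A -> A) :
    (forall a a' b b', F (a \imp a') -> F (a' \imp a) ->
       F (b \imp b') -> F (b' \imp b) -> F (op a b \imp op a' b')) ->
  {morph \pi_Q : a b / op a b >-> lift_op2 Q op a b}.
Proof.
move=> opF a b; rewrite -lock.
have [a1 a2] := repr_imp a; have [b1 b2] := repr_imp b.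
by apply/pi_eq; split; apply: opF.
Qed.

Lemma qmeetE : {morph \pi_Q : a b / (a `&` b)%O >-> qmeet a b}.
Proof.
apply: lift2E => a a' b b' Fa _ Fb _.
apply: filter_up (filterI Fa Fb).
rewrite rl_residuation lexI -!rl_residuation.
apply/andP; split.
- by apply: le_trans (leIl _ _) _; apply: rl_imp_mono; rewrite ?leIl.
- by apply: le_trans (leIr _ _) _; apply: rl_imp_mono; rewrite ?leIr.
Qed.

Lemma qjoinE : {morph \pi_Q : a b / (a `|` b)%O >-> qjoin a b}.
Proof.
apply: lift2E => a a' b b' Fa _ Fb _.
apply: filter_up (filterI Fa Fb).
rewrite rl_residuation rlmulC -rl_residuation leUx; apply/andP; split.
- rewrite rl_residuation rlmulC -rl_residuation.
  by apply: le_trans (leIl _ _) _; apply: rl_imp_mono; rewrite ?leUl.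
- rewrite rl_residuation rlmulC -rl_residuation.
  by apply: le_trans (leIr _ _) _; apply: rl_imp_mono; rewrite ?leUr.
Qed.

Lemma qmulE : {morph \pi_Q : a b / a \odot b >-> qmul a b}.
Proof.
apply: lift2E => a a' b b' Fa _ Fb _.
apply: filter_up (filter_mul Fa Fb).
rewrite rl_residuation.
rewrite rlmulACA [_ \odot a]rlmulC [_ \odot b]rlmulC.
by apply: rl_mul_mono; exact: rl_mulimp.
Qed.

Lemma qimpE : {morph \pi_Q : a b / a \imp b >-> qimp a b}.
Proof.
apply: lift2E => a a' b b' _ Fa Fb _.
apply: filter_up (filter_mul Fa Fb).
rewrite rl_residuation.
have -> : (a' \imp a) \odot (b \imp b') \odot (a \imp b) =
          ((a' \imp a) \odot (a \imp b)) \odot (b \imp b').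
  by rewrite -!rlmulA; congr (_ \odot _); rewrite rlmulC.
apply: le_trans (rl_imp_trans a' b b').
by apply: rl_mul_mono (rl_imp_trans _ _ _) (lexx _).
Qed.

Lemma qle_refl : reflexive qle.
Proof. by elim/quotW=> a; rewrite qleE; apply/asboolP/filter_le. Qed.

Lemma qle_anti : antisymmetric qle.
Proof.
elim/quotW=> a; elim/quotW=> b; rewrite !qleE => /andP[/asboolP ab /asboolP ba].
exact/pi_eq.
Qed.

Lemma qle_trans : transitive qle.
Proof.
elim/quotW=> b; elim/quotW=> a; elim/quotW=> c; rewrite !qleE.
by move=> /asboolP ab /asboolP bc; apply/asboolP; exact: filter_imp_trans ab bc.
Qed.

HB.instance Definition _ :=
  Order.Le_isPOrder.Build d rlquotient qle_refl qle_anti qle_trans.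

Let pi_op2 := (=^~ qmeetE, =^~ qjoinE, =^~ qmulE, =^~ qimpE).

Fact qmeetC : commutative qmeet.
Proof. by elim/quotW=> a; elim/quotW=> b; rewrite !pi_op2 meetC. Qed.

Fact qjoinC : commutative qjoin.
Proof. by elim/quotW=> a; elim/quotW=> b; rewrite !pi_op2 joinC. Qed.

Fact qmeetA : associative qmeet.
Proof.
by elim/quotW=> a; elim/quotW=> b; elim/quotW=> c; rewrite !pi_op2 meetA.
Qed.

Fact qjoinA : associative qjoin.
Proof.
by elim/quotW=> a; elim/quotW=> b; elim/quotW=> c; rewrite !pi_op2 joinA.
Qed.

Fact qjoinKI (y x : Q) : qmeet x (qjoin x y) = x.
Proof. by elim/quotW: x => a; elim/quotW: y => b; rewrite !pi_op2 joinKI. Qed.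

Fact qmeetKU (y x : Q) : qjoin x (qmeet x y) = x.
Proof. by elim/quotW: x => a; elim/quotW: y => b; rewrite !pi_op2 meetKU. Qed.

Fact qleEmeet (x y : Q) : (x <= y) = (qmeet x y == x).
Proof.
elim/quotW: x => a; elim/quotW: y => b; rewrite !pi_op2.
rewrite [LHS]qleE; apply/asboolP/eqP => [ab|/pi_eq[_ ab]].
- apply/pi_eq; split; first by apply: filter_le; exact: leIl.
  apply: filter_up ab; rewrite rl_residuation lexI -!rl_residuation.
  by rewrite lexx andbT (le_trans (lex1 _))// le1x rl_imp_top.
- by apply: filter_up ab; apply: rl_imp_mono => //; exact: leIr.
Qed.

HB.instance Definition _ := Order.POrder_isLattice.Build d rlquotient
  qmeetC qjoinC qmeetA qjoinA qjoinKI qmeetKU qleEmeet.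

Fact qle0x (x : Q) : \pi_Q \bot <= x.
Proof. by elim/quotW: x => a; rewrite [_ <= _]qleE; apply/asboolP/filter_le/le0x. Qed.

Fact qlex1 (x : Q) : x <= \pi_Q \top.
Proof. by elim/quotW: x => a; rewrite [_ <= _]qleE; apply/asboolP/filter_le/lex1. Qed.

HB.instance Definition _ := Order.hasBottom.Build d rlquotient qle0x.
HB.instance Definition _ := Order.hasTop.Build d rlquotient qlex1.

Fact qmulA : associative qmul.
Proof.
by elim/quotW=> a; elim/quotW=> b; elim/quotW=> c; rewrite !pi_op2 rlmulA.
Qed.

Fact qmulC : commutative qmul.
Proof. by elim/quotW=> a; elim/quotW=> b; rewrite !pi_op2 rlmulC. Qed.

Fact qmul1x : left_id (\top : Q) qmul.
Proof. by elim/quotW=> a; rewrite !pi_op2 rlmul1x. Qed.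

Fact q_residuation (x y z : Q) : (x <= qimp y z) = (qmul x y <= z).
Proof.
elim/quotW: x => a; elim/quotW: y => b; elim/quotW: z => c; rewrite !pi_op2.
rewrite [LHS]qleE [RHS]qleE; by rewrite rl_imp_mul.
Qed.

HB.instance Definition _ :=
  isResiduated.Build d rlquotient qmulA qmulC qmul1x q_residuation.

Lemma pi_rl_morph :
  [/\ {morph \pi_Q : a b / (a `&` b)%O}, {morph \pi_Q : a b / (a `|` b)%O},
      {morph \pi_Q : a b / a \odot b}, {morph \pi_Q : a b / a \imp b}
    & \pi_Q \bot = \bot :> Q /\ \pi_Q \top = \top :> Q].
Proof.
by split; [exact: qmeetE|exact: qjoinE|exact: qmulE|exact: qimpE|].
Qed.

End Quotient.

Notation "A '/f' F" := (@rlquotient _ A F)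
  (at level 40, F at level 39, left associativity) : type_scope.
Notation "a '/c' F" := (\pi_(rlquotient F) a)
  (at level 40, F at level 39, left associativity) : rl_scope.

Section Product.
Context {d : Order.disp_t} {I : Type}.
Variable B : I -> residuatedLatticeType d.

Definition rlproduct : Type := forall i, B i.

HB.instance Definition _ := Choice.copy rlproduct (forall i, B i).

Implicit Types f g h : rlproduct.

Definition ple f g : bool := `[< forall i, f i <= g i >].
Definition pmeet f g : rlproduct := fun i => (f i `&` g i)%O.
Definition pjoin f g : rlproduct := fun i => (f i `|` g i)%O.
Definition pmul f g : rlproduct := fun i => f i \odot g i.
Definition pimp f g : rlproduct := fun i => f i \imp g i.

Fact ple_refl : reflexive ple.
Proof. by move=> f; apply/asboolP. Qed.

Fact ple_anti : antisymmetric ple.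
Proof.
move=> f g /andP[/asboolP fg /asboolP gf].
by apply: functional_extensionality_dep => i; apply: le_anti; rewrite fg gf.
Qed.

Fact ple_trans : transitive ple.
Proof.
by move=> g f h /asboolP fg /asboolP gh; apply/asboolP => i; exact: le_trans (gh i).
Qed.

HB.instance Definition _ :=
  Order.Le_isPOrder.Build d rlproduct ple_refl ple_anti ple_trans.

Fact pmeetP f g h : (f <= pmeet g h) = (f <= g) && (f <= h).
Proof.
apply/asboolP/andP => [H|[/asboolP H1 /asboolP H2] i].
  by split; apply/asboolP => i; have := H i; rewrite lexI => /andP[].
by rewrite lexI H1 H2.
Qed.

Fact pjoinP f g h : (pjoin f g <= h) = (f <= h) && (g <= h).
Proof.
apply/asboolP/andP => [H|[/asboolP H1 /asboolP H2] i].
  by split; apply/asboolP => i; have := H i; rewrite leUx => /andP[].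
by rewrite leUx H1 H2.
Qed.

HB.instance Definition _ :=
  Order.POrder_MeetJoin_isLattice.Build d rlproduct pmeetP pjoinP.

Definition pbot : rlproduct := fun i => \bot.
Definition ptop : rlproduct := fun i => \top.

Fact ple0x f : pbot <= f.
Proof. by apply/asboolP => i; exact: le0x. Qed.

Fact plex1 f : f <= ptop.
Proof. by apply/asboolP => i; exact: lex1. Qed.

HB.instance Definition _ := Order.hasBottom.Build d rlproduct ple0x.
HB.instance Definition _ := Order.hasTop.Build d rlproduct plex1.

Fact pmulA : associative pmul.
Proof. by move=> f g h; apply: functional_extensionality_dep => i; exact: rlmulA. Qed.

Fact pmulC : commutative pmul.
Proof. by move=> f g; apply: functional_extensionality_dep => i; exact: rlmulC. Qed.

Fact pmul1x : left_id (\top : rlproduct) pmul.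
Proof. by move=> f; apply: functional_extensionality_dep => i; exact: rlmul1x. Qed.

Fact p_residuation f g h : (f <= pimp g h) = (pmul f g <= h).
Proof. by apply: asbool_equiv_eq; split=> H i; have := H i; rewrite rl_residuation. Qed.

HB.instance Definition _ :=
  isResiduated.Build d rlproduct pmulA pmulC pmul1x p_residuation.

End Product.

Definition rl_isomorphic d d' (A : residuatedLatticeType d)
    (B : residuatedLatticeType d') : Prop :=
  exists f : {tblmorphism A -> B},
    [/\ {morph f : a b / a \odot b}, {morph f : a b / a \imp b} & bijective f].

Definition boolean_center d (L : tbLatticeType d) : set L :=
  [set e | exists e', e `&` e' = \bot /\ e `|` e' = \top].

Arguments boolean_center {d} L _.

Section LiftingMaximality.
Context {d : Order.disp_t} (A : residuatedLatticeType d).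

Definition filter_BLP (F : rlfilter A) : Prop :=
  forall f : A /f F, boolean_center (A /f F) f ->
    exists2 e : A, boolean_center A e & e /c F = f.

Definition BLP : Prop := forall F : rlfilter A, filter_BLP F.

Definition is_maximal : Prop :=
  forall (I : Type) (a : I -> A) (F : I -> rlfilter A),
    (forall J : set I, finite_set J ->
       exists x : A, forall i, J i -> x /c F i = a i /c F i) ->
    exists x : A, forall i, x /c F i = a i /c F i.

End LiftingMaximality.

(* Main.v *)
Require Import Defs.
From HB Require Import structures.
From mathcomp Require Import all_boot all_order.
From mathcomp Require Import generic_quotient.
From mathcomp Require Import boolp classical_sets cardinality.

Set Implicit Arguments.
Unset Strict Implicit.
Unset Printing Implicit Defensive.

Import Order.TTheory.
Local Open Scope classical_set_scope.
Local Open Scope quotient_scope.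
Local Open Scope order_scope.
Local Open Scope rl_scope.

(** Write ¬x for x -> 0.

    From maximality and lifting modulo the radical to a product of local
    factors.  Two distinct maximal filters are comaximal
    ([maximal_filter_separate]), so for a maximal filter M and finitely many
    others there is x congruent to 0 modulo M and to 1 modulo the others.  As A
    is maximal, one x serves for all the maximal filters other than M
    ([maximal_filter_avoid]).  This forces the set of maximal filters to be
    finite ([finite_maximal_filter]), as in Zelinsky's argument for linearly
    compact rings.  For each M the class of ¬x modulo Rad(A) is complemented,
    and it lifts to a complemented element e_M of A ([boolean_avoid]) with
    e_M in M and ¬e_M in every other maximal filter.  An idempotent in no
    maximal filter is 0, hence the e_M are pairwise disjoint; similarly an
    upper bound of all of them is 1.  Therefore A is isomorphic to the product
    of its quotients by the principal filters of the e_M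
    ([decomp_isomorphic]).  Each quotient is maximal, being an image of A
    ([is_maximal_image]), and local, because M is the only maximal filter that
    contains e_M ([is_local_image]).

    From a finite product of local maximal factors to maximality and lifting.
    A filter of a finite product is the product of its projections
    ([filter_coord]), so both properties can be checked in each coordinate.
    For maximality this is immediate ([is_maximal_product]).  For lifting, a
    complemented class in a quotient of a local residuated lattice is the class
    of 0 or of 1 ([local_complemented_mod]), and 0 and 1 are complemented
    ([BLP_local_product]). *)

(** * Residuated arithmetic *)

Section Arithmetic.
Context {d : Order.disp_t} {A : residuatedLatticeType d}.
Implicit Types a b c x y z : A.

Lemma rl_mulx0 a : a \odot \bot = \bot.
Proof. by apply/eqP; rewrite -lex0 rlmulC -rl_residuation le0x. Qed.

Lemma rl_mul_ler a b : a \odot b <= b.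
Proof. by rewrite (le_trans (rl_mul_leI a b))// leIr. Qed.

Lemma rl_mul_lel a b : a \odot b <= a.
Proof. by rewrite (le_trans (rl_mul_leI a b))// leIl. Qed.

Lemma rl_mulUl a b c : (a `|` b) \odot c = a \odot c `|` b \odot c.
Proof.
apply/le_anti/andP; split.
  by rewrite -rl_residuation leUx !rl_residuation leUl leUr.
by rewrite leUx !rl_mul_mono ?leUl ?leUr.
Qed.

Lemma rl_le_imp a b : b <= a \imp b.
Proof. by rewrite rl_residuation rl_mul_lel. Qed.

Lemma rl_join_mul_top x a b : x `|` a = \top -> x `|` b = \top ->
  x `|` a \odot b = \top.
Proof.
move=> xa xb; apply/eqP; rewrite -le1x.
rewrite -[leLHS]rlmul1x -{1}xa -xb rl_mulUl leUx; apply/andP; split.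
  by rewrite lexU2 // rl_mul_lel.
rewrite rlmulC rl_mulUl leUx; apply/andP; split.
  by rewrite lexU2 // rl_mul_lel.
by rewrite rlmulC leUr.
Qed.

Lemma boolean_idem e : boolean_center A e -> e \odot e = e.
Proof.
case=> e' [ee0 ee1]; apply/le_anti/andP; split; first exact: rl_mul_lel.
rewrite -{1}[e]rlmul1x -ee1 rl_mulUl leUx lexx /=.
by rewrite (le_trans (rl_mul_leI _ _))// meetC ee0 le0x.
Qed.

End Arithmetic.

(** * Filters *)

Section Filters.
Context {d : Order.disp_t} {A : residuatedLatticeType d}.
Implicit Types (F G M N : set A) (x y z u : A).

Lemma proper_filterP F : is_filter F -> proper_filter F <-> ~ F \bot.
Proof.
move=> Ff; split=> [[_ FT] F0|F0]; last by split=> // FT; apply: F0; rewrite FT.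
by apply: FT; apply/seteqP; split=> // x _; case: Ff => _ _; apply; [exact: le0x|].
Qed.

Lemma is_filter_top F : is_filter F -> F \top.
Proof. by move=> Ff; exact: (filter_top (RLFilter Ff)). Qed.

Lemma maximal_filter_exists F :
  proper_filter F -> exists2 M, maximal_filter M & F `<=` M.
Proof.
move=> Fp.
(* The union of the empty chain is empty, so the empty set is allowed too. *)
pose P X := X = set0 \/ proper_filter X /\ F `<=` X.
have [|M [[M0|[Mp FM]] Mmax]] := @Zorn_bigcup A P.
- move=> C CP Ctot.
  have [[X CX X0]|noX] := pselect (exists2 X, C X & X <> set0); last first.
    left; apply/seteqP; split=> // x [X CX Xx]; apply: noX; exists X => //.
    by move=> X0; rewrite X0 in Xx.
  right; case: (CP _ CX) => // -[Xp FX]; split; last first.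
    by move=> x Fx; exists X => //; exact: FX.
  have Cf Y y : C Y -> Y y -> proper_filter Y.
    by move=> /CP[->//|[]].
  have Uf : is_filter (\bigcup_(X in C) X).
    split; first by exists \top, X => //; apply: is_filter_top; case: Xp.
      move=> x y [Y CY Yx] [Z CZ Zy].
      case: (Ctot _ _ CY CZ) => YZ.
        exists Z => //; have [[_ Zm _] _] := Cf _ _ CZ Zy.
        by apply: Zm => //; exact: YZ.
      exists Y => //; have [[_ Ym _] _] := Cf _ _ CY Yx.
      by apply: Ym => //; exact: YZ.
    move=> x y xy [Y CY Yx]; exists Y => //; have [[_ _ Yu] _] := Cf _ _ CY Yx.
    exact: Yu xy Yx.
  apply/(proper_filterP Uf) => -[Y CY Y0].
  by have Yp := Cf _ _ CY Y0; have [Yf _] := Yp; move/(proper_filterP Yf): Yp.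
- have F1 : F \top by apply: is_filter_top; case: Fp.
  exfalso; apply: (Mmax F); last by right; split.
  by rewrite M0; split; [exact: sub0set|move=> /(_ _ F1)].
- exists M => //; split=> // G Gp MG; apply: contrapT => GM.
  apply: (Mmax G); last by right; split=> //; exact: subset_trans MG.
  by split=> // GleM; apply: GM; apply/seteqP.
Qed.

(** The principal up-set of [u], a filter exactly when [u] is idempotent. *)
Definition upset u : set A := [set x | u <= x].

Lemma upset_filter u : u \odot u = u -> is_filter (upset u).
Proof.
move=> uu; split=> [|x y ux uy|x y xy ux].
- by exists \top; exact: lex1.
- by rewrite /upset /= -uu rl_mul_mono.
- exact: le_trans xy.
Qed.

(** The only idempotent that lies in no maximal filter is the bottom. *)
Lemma idem_in_maximal u : u \odot u = u -> u != \bot ->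
  exists2 M, maximal_filter M & M u.
Proof.
move=> uu u0; have uf := upset_filter uu.
have /maximal_filter_exists[M Mm uM] : proper_filter (upset u).
  by apply/(proper_filterP uf); rewrite /upset /= lex0; apply/negP.
by exists M => //; apply: uM; exact: lexx.
Qed.

Lemma maximal_filter_neg M x : maximal_filter M -> M x -> ~ M (x \imp \bot).
Proof.
move=> [Mp _] Mx Mnx; have [Mf _] := Mp; move/(proper_filterP Mf): Mp; apply.
by have [_ Mm Mu] := Mf; apply: (Mu _ _ (rl_mulimp x \bot)); exact: Mm.
Qed.

(** Distinct maximal filters are comaximal: their join contains the bottom, so
    some element is congruent to the top modulo one and to the bottom modulo
    the other. *)
Lemma maximal_filter_separate M N : maximal_filter M -> maximal_filter N ->
  M <> N -> exists2 u, M u & N (u \imp \bot).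
Proof.
move=> [Mp Mm] [Np Nm] MN; have [Mf _] := Mp; have [Nf _] := Np.
have [[Mi Mmul Mu] [Ni Nmul Nu]] := (Mf, Nf).
(* J is the join of M and N in the lattice of filters. *)
pose J : set A := [set z | exists u v, [/\ M u, N v & u \odot v <= z]].
have Jf : is_filter J.
  split.
  - exists \top, \top, \top; split; [exact: is_filter_top..|exact: lex1].
  - move=> x y [u [v [Mu' Nv uvx]]] [u' [v' [Mu'' Nv' uvy]]].
    exists (u \odot u'), (v \odot v'); split; [exact: Mmul|exact: Nmul|].
    by rewrite rlmulACA rl_mul_mono.
  - move=> x y xy [u [v [? ? uvx]]]; exists u, v; split=> //.
    exact: le_trans xy.
have MJ : M `<=` J.
  move=> x Mx; exists x, \top; split; rewrite ?rlmulx1 //; exact: is_filter_top.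
have NJ : N `<=` J.
  move=> x Nx; exists \top, x; split; rewrite ?rlmul1x //; exact: is_filter_top.
have [J0|] := pselect (J \bot); last first.
  by move=> /(proper_filterP Jf) Jp; case: MN; rewrite -(Mm _ Jp MJ) (Nm _ Jp NJ).
have [u [v [Mx Nv uv0]]] := J0; exists u => //.
by apply: Nu Nv; rewrite rl_residuation rlmulC.
Qed.

End Filters.

(** * Morphisms *)

Section Morphisms.
Context {d d' : Order.disp_t}.
Context {A : residuatedLatticeType d} {B : residuatedLatticeType d'}.

(** Homomorphisms of residuated lattices, as a predicate on plain functions. *)
Definition rl_morphism (f : A -> B) :=
  [/\ {morph f : a b / (a `&` b)%O}, {morph f : a b / (a `|` b)%O},
      {morph f : a b / a \odot b}, {morph f : a b / a \imp b}
    & f \bot = \bot /\ f \top = \top].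

Variable f : A -> B.
Hypothesis f_morph : rl_morphism f.

Let fI a b : f (a `&` b) = (f a `&` f b)%O. Proof. by case: f_morph. Qed.
Let fU a b : f (a `|` b) = (f a `|` f b)%O. Proof. by case: f_morph. Qed.
Let fM a b : f (a \odot b) = f a \odot f b. Proof. by case: f_morph. Qed.
Let fi a b : f (a \imp b) = f a \imp f b. Proof. by case: f_morph. Qed.
Let f0 : f \bot = \bot. Proof. by case: f_morph => _ _ _ _ []. Qed.
Let f1 : f \top = \top. Proof. by case: f_morph => _ _ _ _ []. Qed.

Lemma rl_morphism_le a b : a <= b -> f a <= f b.
Proof. by rewrite -!rl_imp_top -fi => /eqP ->; rewrite f1. Qed.

Lemma filter_preimage (F : set B) : is_filter F -> is_filter (f @^-1` F).
Proof.
move=> Ff; have [_ Fm Fu] := Ff; split=> [|a b|a b ab].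
- by exists \top; rewrite /preimage /= f1; exact: is_filter_top.
- by rewrite /preimage /= fM; exact: Fm.
- by apply: Fu; exact: rl_morphism_le.
Qed.

Hypothesis f_surj : forall y, exists x, f x = y.

Lemma filter_image (F : set A) : is_filter F -> is_filter (f @` F).
Proof.
move=> Ff; have [_ Fm Fu] := Ff; split=> [|_ _ [a Fa <-] [b Fb <-]|].
- by exists (f \top), \top => //; exact: is_filter_top.
- by exists (a \odot b) => //; exact: Fm.
- move=> x y xy [a Fa ax]; have [b by_] := f_surj y.
  exists (a `|` b); first by apply: Fu Fa; exact: leUl.
  by rewrite fU ax by_; exact/join_idPr.
Qed.

(** Pulling the filters back along [f] and lifting the elements turns a finitely
    solvable system over [B] into one over [A]. *)
Lemma is_maximal_image : is_maximal A -> is_maximal B.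
Proof.
move=> Amax I b F bF; have [g gK] := choice f_surj.
pose G i := RLFilter (filter_preimage (rlfilterP (F i))).
have FG i x y : G i (x \eqv y) <-> F i (f x \eqv f y).
  by rewrite /G /= /preimage /= fI !fi.
have [|x xP] := Amax I (g \o b) G.
  move=> J /bF[y yP]; exists (g y) => i Ji.
  by apply/pi_eqv/FG; rewrite /= !gK; apply/pi_eqv/yP.
by exists (f x) => i; have /pi_eqv/FG := xP i; rewrite /= gK => /pi_eqv.
Qed.

Lemma maximal_preimage (N : set B) :
  maximal_filter N -> maximal_filter (f @^-1` N).
Proof.
move=> [[Nf NT] Nmax]; have [_ Nm _] := Nf.
have N0 : ~ N \bot by apply/proper_filterP.
have fNf := filter_preimage Nf; split.
  by apply/(proper_filterP fNf); rewrite /preimage /= f0.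
move=> P Pp NP; have [Pf _] := Pp; have Pimf := filter_image Pf.
apply/seteqP; split=> // p Pp'; rewrite /preimage /=.
rewrite -(Nmax (f @` P)); first by exists p.
- apply/(proper_filterP Pimf) => -[q Pq fq0].
  have Pnq : P (q \imp \bot).
    by apply: NP; rewrite /preimage /= fi fq0 f0 rl_impxx; exact: is_filter_top.
  move/(proper_filterP Pf): Pp; apply.
  have [_ Pm Pu] := Pf; apply: Pu (rl_mulimp q _) _; exact: Pm.
- move=> y Ny; have [x xy] := f_surj y; exists x => //.
  by apply: NP; rewrite /preimage /= xy.
Qed.

(** A quotient is local as soon as exactly one maximal filter contains
    its kernel. *)
Lemma is_local_image (M : set A) :
  maximal_filter M ->
  (forall N, maximal_filter N -> (forall x, f x = \top -> N x) -> N = M) ->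
  (forall x, f x = \top -> M x) ->
  is_local B.
Proof.
move=> [Mp _] Muniq kerM; have [Mf _] := Mp.
move/(proper_filterP Mf): Mp => M0.
have /maximal_filter_exists[N Nmax _] : proper_filter (upset (\top : B)).
  have Tf := upset_filter (rlmulx1 (\top : B)).
  apply/(proper_filterP Tf); rewrite /upset /= le1x => /eqP B0.
  by apply/M0/kerM; rewrite f0.
have preM N' : maximal_filter N' -> f @^-1` N' = M.
  move=> N'max; apply: Muniq; first exact: maximal_preimage.
  move=> x fx1; rewrite /preimage /= fx1.
  by apply: is_filter_top; case: N'max => -[].
exists N; split=> // N' N'max; apply/seteqP; split=> y; have [x <-] := f_surj y.
- by rewrite -[N (f x)]/((f @^-1` N) x) preM// -(preM N').
- by rewrite -[N' (f x)]/((f @^-1` N') x) preM// -(preM N).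
Qed.

End Morphisms.

(** * Local residuated lattices *)

(** A nontrivial quotient of a local residuated lattice has no complemented
    elements besides its bounds: [p] and [q] are complements modulo [G], and
    [p] is then congruent to the top or to the bottom. *)
Lemma local_complemented_mod d (A : residuatedLatticeType d) (G : rlfilter A)
    (p q : A) : is_local A ->
  G ((p `&` q) \imp \bot) -> G (p `|` q) -> G p \/ G (p \imp \bot).
Proof.
move=> [M [Mmax Muniq]]; have [Mp _] := Mmax; have [Mf _] := Mp.
move/(proper_filterP Mf): Mp => M0.
(* An element r that has a complement modulo G is idempotent modulo G, so H r
   is the filter generated by G and r: no powers of r are needed. *)
pose H (r : A) : set A := [set x | G (r \imp x)].
have Hf r s : G ((r `&` s) \imp \bot) -> G (r `|` s) -> is_filter (H r).
  move=> Grs0 Grs1; have Grr : G (r \imp r \odot r).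
    apply: filter_up (filter_mul Grs0 Grs1).
    rewrite rl_residuation -rlmulA rl_mulUl rlmulC rl_mulUl leUx rl_mul_lel /=.
    rewrite (le_trans _ (le0x _))//.
    rewrite (le_trans _ (rl_mulimp (r `&` s) _))// rl_mul_mono//.
    by rewrite meetC rl_mul_leI.
  split=> [|x y Hx Hy|x y xy].
  - by exists \top; apply: filter_le; exact: lex1.
  - apply: filter_imp_trans Grr _; apply: filter_up (filter_mul Hx Hy).
    rewrite rl_residuation rlmulACA [_ \odot r]rlmulC.
    by rewrite [(r \imp y) \odot r]rlmulC rl_mul_mono ?rl_mulimp.
  - by apply: filter_up; exact: rl_imp_mono.
have GH r x : G x -> H r x by apply: filter_up; exact: rl_le_imp.
have sub_M (F : set A) : is_filter F -> ~ F \bot -> F `<=` M.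
  move=> Ff /(proper_filterP Ff)/maximal_filter_exists[N Nmax].
  by rewrite (Muniq _ Nmax).
move=> Gpq0 Gpq1; have Hpf := Hf _ _ Gpq0 Gpq1.
have Hqf : is_filter (H q) by apply: (Hf _ p); rewrite 1?meetC 1?joinC.
(* If both H p and H q were proper, they would lie in the unique maximal filter
   M, which would then contain p, q and the negation of their meet. *)
have [?|Hp0] := pselect (H p \bot); first by right.
have [Hq0|Hq0] := pselect (H q \bot).
  left; apply: filter_up (filter_mul Gpq1 Hq0).
  by rewrite rl_mulUl leUx rl_mul_lel (le_trans (rl_mulimp _ _) (le0x _)).
have [pM qM] := (sub_M _ Hpf Hp0, sub_M _ Hqf Hq0).
have Hrr r : H r r by apply: filter_le.
have [_ Mm Mu] := Mf; case: M0.
apply: (Mu _ _ (rl_mulimp (p `&` q) \bot)); apply: (Mm); last exact/pM/GH.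
by apply: (Mu _ _ (rl_mul_leI p q)); apply: Mm; [exact: pM|exact: qM].
Qed.

(** * Finite products *)

Section FiniteProducts.
Context {d : Order.disp_t} {A : residuatedLatticeType d}.
Context {I : finType} {B : I -> residuatedLatticeType d}.
Variable f : A -> rlproduct B.
Hypotheses (f_morph : rl_morphism f) (f_bij : bijective f).

Let coord i x : B i := f x i.

Lemma coord_morphism i : rl_morphism (coord i).
Proof.
case: f_morph => fI fU fM fi [f0 f1].
by split; [move=> x y; rewrite /coord ?fI ?fU ?fM ?fi..|rewrite /coord f0 f1].
Qed.

Lemma coord_surj i y : exists x, coord i x = y.
Proof.
have [g _ gK] := f_bij; exists (g (dfwith (fun j => \top : B j) y)).
by rewrite /coord gK dfwith_in.
Qed.

Lemma coord_le x y : (forall i, coord i x <= coord i y) -> x <= y.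
Proof.
move=> xy; have [_ _ _ fi [_ f1]] := f_morph.
rewrite -rl_imp_top; apply/eqP/(bij_inj f_bij); rewrite fi f1.
by apply/eqP; rewrite rl_imp_top; apply/asboolP.
Qed.

(** Every filter of a finite product is the product of its projections. *)
Lemma filter_coord (F : rlfilter A) z :
  (forall i, (coord i @` F) (coord i z)) -> F z.
Proof.
move=> Fz; have /choice[w wP] : forall i, exists x, F x /\ coord i x = coord i z.
  by move=> i; have [x ? ?] := Fz i; exists x.
apply: (@filter_up _ _ F (\meet_i w i)).
  apply: coord_le => i; have [_ <-] := wP i.
  apply: rl_morphism_le; first exact: coord_morphism.
  exact: meets_inf.
elim/big_ind: _ => [|x y|i _]; [exact: filter_top|exact: filterI|].
by have [] := wP i.
Qed.

Let coord_filter (F : rlfilter A) i : rlfilter (B i) :=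
  RLFilter (filter_image (coord_morphism i) (@coord_surj i) (rlfilterP F)).

Lemma is_maximal_product : (forall i, is_maximal (B i)) -> is_maximal A.
Proof.
move=> Bmax K a F aF.
have cE i x y : coord i (x \eqv y) = (coord i x \eqv coord i y).
  by have [cI _ _ ci _] := coord_morphism i; rewrite cI !ci.
have [y yP] : exists y : forall i, B i,
    forall i k, coord_filter (F k) i (y i \eqv coord i (a k)).
  have : forall i, exists y : B i,
      forall k, coord_filter (F k) i (y \eqv coord i (a k)).
    move=> i.
    have [|y yP] := Bmax i K (coord i \o a) (fun k => coord_filter (F k) i).
      move=> J /aF[x xP]; exists (coord i x) => k Jk; apply/pi_eqv.
      by rewrite /= -cE; exists (x \eqv a k) => //; apply/pi_eqv/xP.
    by exists y => k; exact/pi_eqv/yP.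
  move=> /(_ _)/cid yP; exists (fun i => sval (yP i)) => i.
  exact: (svalP (yP i)).
have [g _ gK] := f_bij; exists (g y) => k; apply/pi_eqv/filter_coord => i.
by rewrite cE [coord i (g y)]/coord gK; exact: yP.
Qed.

(** In each coordinate a complemented class is the class of the top or of the
    bottom; the tuple of these bounds is the lift. *)
Lemma BLP_local_product : (forall i, is_local (B i)) -> BLP A.
Proof.
move=> Bloc F u [v []].
rewrite -[u]reprK -[v]reprK; set a := repr u; set b := repr v.
have [pI pU _ _ [p0 p1]] := @pi_rl_morph _ _ F.
rewrite -pI -p0 -pU -p1 => /pi_eq[ab0 _] /pi_eq[_ ab1].
have {}ab1 : F (a `|` b)%O.
  by apply: filter_up ab1; rewrite -[leLHS]rlmul1x rl_mulimp.
have [[fI fU fM fi [f0 f1]] [g fK gK]] := (f_morph, f_bij).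
have dec i : coord_filter F i (coord i a) \/
             coord_filter F i (coord i a \imp \bot).
  have [cI cU _ ci [c0 _]] := coord_morphism i.
  apply: (@local_complemented_mod _ _ _ _ (coord i b)) => //.
    by rewrite -cI -c0 -ci; exists (a `&` b \imp \bot)%O.
  by rewrite -cU; exists (a `|` b)%O.
pose e : rlproduct B := fun i =>
  if `[< coord_filter F i (coord i a) >] then \top else \bot.
pose e' : rlproduct B := fun i =>
  if `[< coord_filter F i (coord i a) >] then \bot else \top.
exists (g e).
  exists (g e'); split; apply: (can_inj fK); rewrite ?fI ?fU !gK ?f0 ?f1.
    apply: functional_extensionality_dep => i; rewrite /Order.meet /=.
    by rewrite /pmeet /e /e'; case: asbool; rewrite ?meet1x ?meetx1.
  apply: functional_extensionality_dep => i; rewrite /Order.join /=.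
  by rewrite /pjoin /e /e'; case: asbool; rewrite ?join1x ?joinx1.
apply/pi_eqv/filter_coord => i.
have [cI _ _ ci _] := coord_morphism i; rewrite cI !ci.
rewrite [coord i (g e)]/coord gK.
apply: (@filterI _ _ (coord_filter F i)); rewrite /e; case: asboolP => ia.
- by apply: (filter_up _ ia); exact: rl_le_imp.
- by apply: filter_le; exact: le0x.
- by apply: filter_le; exact: lex1.
- by case: (dec i).
Qed.

End FiniteProducts.

(** A [{tblmorphism A -> B}] is only required to preserve the bounds. When it is
    bijective, preserving the residuum makes it an order isomorphism, hence it
    preserves meets and joins as well. *)
Lemma isomorphism_morphism d d' (A : residuatedLatticeType d)
    (B : residuatedLatticeType d') (f : {tblmorphism A -> B}) :
  {morph f : a b / a \odot b} -> {morph f : a b / a \imp b} -> bijective f ->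
  rl_morphism f.
Proof.
move=> fM fi fbij; have [g fK gK] := fbij.
have f_le x y : (f x <= f y) = (x <= y).
  by rewrite -!rl_imp_top -fi -[\top in LHS](omorph1 f) (inj_eq (can_inj fK)).
split=> //; last by rewrite omorph0 omorph1.
- move=> x y; apply/le_anti/andP; split.
    by rewrite lexI !f_le leIl leIr.
  by rewrite -[leLHS]gK f_le lexI -!f_le gK leIl leIr.
- move=> x y; apply/le_anti/andP; split; last by rewrite leUx !f_le leUl leUr.
  by rewrite -[leRHS]gK f_le leUx -!f_le gK leUl leUr.
Qed.

(** * Decomposing a maximal residuated lattice *)

Section Decomposition.
Context {d : Order.disp_t} {A : residuatedLatticeType d}.
Implicit Types (M N : set A) (x y z e : A).

(** For a maximal filter [M] and finitely many others, some element is congruent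
    to the bottom modulo [M] and to the top modulo all the others. *)
Lemma maximal_filter_avoid_seq M (s : seq (set A)) : maximal_filter M ->
  (forall N, N \in s -> maximal_filter N /\ N <> M) ->
  exists x, M (x \imp \bot) /\ forall N, N \in s -> N x.
Proof.
move=> Mmax; have [[[_ Mm Mu] _] _] := Mmax.
elim: s => [_|N s IHs sP].
  exists \bot; split=> //; rewrite rl_impxx.
  by apply: is_filter_top; case: Mmax => -[].
have [Nmax NM] := sP N (mem_head _ _).
have [|x [Mx sx]] := IHs; first by move=> N' sN'; apply: sP; rewrite inE sN' orbT.
have [u Nu Mu'] := maximal_filter_separate Nmax Mmax NM.
exists (x `|` u)%O; split.
  apply: (Mu _ _ _ (Mm _ _ Mx Mu')).
  rewrite rl_residuation rlmulC rl_mulUl leUx; apply/andP; split.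
    by rewrite rlmulA (le_trans (rl_mul_lel _ _)) ?rl_mulimp.
  by rewrite rlmulC -rlmulA (le_trans (rl_mul_ler _ _))// rlmulC rl_mulimp.
move=> N'; rewrite inE => /predU1P[->|sN'].
  by have [[[_ _ Nup] _] _] := Nmax; apply: Nup Nu; exact: leUr.
have [[[[_ _ Nup] _] _] _] : maximal_filter N' /\ N' <> M.
  by apply: sP; rewrite inE sN' orbT.
by apply: Nup (sx _ sN'); exact: leUl.
Qed.

(** The maximality of [A] yields one element that works for all the maximal
    filters other than [M] at once. *)
Lemma maximal_filter_avoid M : is_maximal A -> maximal_filter M ->
  exists x, M (x \imp \bot) /\ forall N, maximal_filter N -> N <> M -> N x.
Proof.
move=> Amax Mmax.
pose K := {N : set A | maximal_filter N}.
have Kf (k : K) : is_filter (sval k) by case: (svalP k) => -[].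
pose a (k : K) : A := if `[< sval k = M >] then \bot else \top.
have [|x xP] := Amax K a (fun k => RLFilter (Kf k)).
  move=> J Jfin; have /finite_seqP[s sJ] := finite_image sval Jfin.
  have [|x [Mx sx]] := @maximal_filter_avoid_seq M [seq N <- s | N != M] Mmax.
    move=> N; rewrite mem_filter => /andP[/eqP NM sN]; split=> //.
    suff [k _ <-] : (sval @` J) N by exact: svalP.
    by rewrite sJ.
  exists x => k Jk; apply/pi_eqv/filter_eqv; rewrite /a; case: asboolP => kM /=.
    split; first by rewrite kM.
    by apply: (@filter_le _ _ (RLFilter (Kf k))); exact: le0x.
  split; first by apply: (@filter_le _ _ (RLFilter (Kf k))); exact: lex1.
  apply: (@filter_up _ _ (RLFilter (Kf k)) _ _ (rl_le_imp \top x)).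
  apply: sx; rewrite mem_filter; apply/andP; split; first exact/eqP.
  by have : (sval @` J) (sval k) by [exists k]; rewrite sJ.
exists x; split.
  have := xP (exist _ M Mmax); move/pi_eqv/filter_eqv; rewrite /a /=.
  by case: asboolP => // _ [].
move=> N Nmax NM.
have := xP (exist _ N Nmax); move/pi_eqv/filter_eqv; rewrite /a /=.
case: asboolP => // _ [_].
apply: (@filter_up _ _ (RLFilter (Kf (exist _ N Nmax)))).
by rewrite -[leLHS]rlmul1x rl_mulimp.
Qed.

(** If there were infinitely many maximal filters, the elements that lie in all
    but finitely many of them would form a proper filter, hence be contained in
    a maximal filter [M]; but [maximal_filter_avoid] gives such an element
    outside [M]. *)
Lemma finite_maximal_filter :
  is_maximal A -> finite_set [set M : set A | maximal_filter M].
Proof.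
move=> Amax.
pose C x : set (set A) := [set M | maximal_filter M /\ ~ M x].
pose D : set A := [set x | finite_set (C x)].
have Df : is_filter D.
  split.
  - exists \top; rewrite /D /= (_ : C _ = set0); first exact: finite_set0.
    by apply/seteqP; split=> // M [[[Mf _] _] []]; exact: is_filter_top.
  - move=> x y Dx Dy; have : finite_set (C x `|` C y) by rewrite finite_setU.
    apply: sub_finite_set => M [Mmax Mxy]; have [[[_ Mm _] _] _] := Mmax.
    have [Mx|?] := pselect (M x); last by left.
    by right; split=> // My; apply: Mxy; exact: Mm.
  - move=> x y xy; apply: sub_finite_set => M [Mmax My]; split=> // Mx.
    by have [[[_ _ Mu] _] _] := Mmax; apply: My; exact: Mu xy Mx.
apply: contrapT => infM.
have /maximal_filter_exists[M Mmax DM] : proper_filter D.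
  apply/(proper_filterP Df) => D0; apply: infM; apply: sub_finite_set D0 => M Mmax.
  by split=> //; have [Mp _] := Mmax; have [Mf _] := Mp; apply/proper_filterP.
have [x [Mx0 Mx]] := maximal_filter_avoid Amax Mmax.
have /DM {}Mx : D x.
  apply: sub_finite_set (finite_set1 M) => N [Nmax Nx].
  by apply: contrapT => NM; apply: Nx; exact: Mx.
exact: (maximal_filter_neg Mmax Mx).
Qed.

(** The element given by [maximal_filter_avoid] is complemented modulo the
    radical, so it can be replaced by a complemented element of [A]. *)
Lemma boolean_avoid M :
  is_maximal A -> filter_BLP (Rad A) -> maximal_filter M ->
  exists e, [/\ boolean_center A e, M e &
    forall N, maximal_filter N -> N <> M -> N (e \imp \bot)].
Proof.
move=> Amax RadBLP Mmax; have [x [Mx Nx]] := maximal_filter_avoid Amax Mmax.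
have [[_ _ Mu] _] : proper_filter M by case: Mmax.
have Rad_eq a b : Rad A (a \imp b) -> Rad A (b \imp a) ->
    a /c (Rad A) = b /c (Rad A).
  by move=> ab ba; apply/pi_eq.
set nx := x \imp \bot.
have caseN N : maximal_filter N -> N x \/ N nx.
  move=> Nmax; have [->|NM] := pselect (N = M); first by right.
  by left; exact: Nx.
have [pI pU _ _ [p0 p1]] := @pi_rl_morph _ _ (Rad A).
have [|e eB enx] := RadBLP (nx /c (Rad A)).
  exists (x /c (Rad A)); rewrite -pI -p0 -pU -p1; split; apply: Rad_eq.
  - move=> N Nmax; have [[[_ _ Nu] _] _] := Nmax.
    case: (caseN _ Nmax) => h; apply: Nu h.
      rewrite rl_residuation (le_trans _ (rl_mulimp x \bot))//.
      by rewrite rl_mul_mono ?leIl.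
    rewrite rl_residuation rlmulC (le_trans _ (rl_mulimp x \bot))//.
    by rewrite rl_mul_mono ?leIr.
  - by apply: filter_le; exact: le0x.
  - by apply: filter_le; exact: lex1.
  - move=> N Nmax; have [[[_ _ Nu] _] _] := Nmax.
    case: (caseN _ Nmax) => h; apply: Nu h.
      exact: le_trans (leUr _ _) (rl_le_imp _ _).
    exact: le_trans (leUl _ _) (rl_le_imp _ _).
move/pi_eq: enx => [Renx Rnxe]; exists e; split=> //.
  apply: (Mu _ _ (rl_mulimp nx e)).
  by have [[[_ Mm _] _] _] := Mmax; apply: Mm => //; exact: Rnxe.
move=> N Nmax NM; have [[[_ Nm Nu] _] _] := Nmax.
apply: (Nu _ _ _ (Nm _ _ (Renx N Nmax) (Nx N Nmax NM))).
rewrite rl_residuation rlmulC rlmulA (le_trans _ (rl_mulimp x \bot))//.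
by rewrite rlmulC rl_mul_mono// rl_mulimp.
Qed.

Section BooleanDecomposition.
Context {I : finType}.
Variable e : I -> A.
Hypotheses (e_bool : forall i, boolean_center A (e i))
           (e_disj : forall i j, i != j -> e i \odot e j = \bot)
           (e_cover : forall z, (forall i, e i <= z) -> z = \top).

(** The principal filter of the idempotent [e i]. *)
Definition upset_rlfilter i : rlfilter A :=
  RLFilter (upset_filter (boolean_idem (e_bool i))).

(** The canonical map to the product of the quotients by these filters. *)
Definition decomp (x : A) :
    rlproduct (fun i => rlquotient (upset_rlfilter i)) :=
  fun i => x /c upset_rlfilter i.

Lemma decomp_bot : decomp \bot = \bot. Proof. by []. Qed.
Lemma decomp_top : decomp \top = \top. Proof. by []. Qed.

HB.instance Definition _ :=
  Order.isBLatticeMorphism.Build d A d _ decomp decomp_bot.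
HB.instance Definition _ :=
  Order.isTLatticeMorphism.Build d A d _ decomp decomp_top.

Lemma decomp_bij : bijective decomp.
Proof.
have eqvP i x y : decomp x i = decomp y i <-> e i <= (x \eqv y) by exact: pi_eqv.
have dec_inj : injective decomp.
  move=> x y xy; have /eqP : (x \eqv y) = \top.
    by apply: e_cover => i; apply/eqvP; rewrite xy.
  rewrite -le1x lexI !le1x !rl_imp_top => /andP[? ?].
  by apply/le_anti/andP.
suff /choice[g gK] : forall q, exists x, decomp x = q.
  by exists g => // x; apply: dec_inj; rewrite gK.
(* Modulo the principal filter of e i, the join of the a j \odot e j is a i,
   because e i is congruent to the top and every other e j to the bottom. *)
move=> q; pose a i := repr (q i); exists (\join_i (a i \odot e i))%O.
apply: functional_extensionality_dep => i; rewrite -[RHS]reprK; apply/eqvP.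
rewrite lexI; apply/andP; split.
  rewrite rl_residuation rlmulC -rl_residuation; apply/joinsP => j _.
  rewrite rl_residuation; have [<-|ij] := eqVneq i j.
    by rewrite -rlmulA rl_mul_lel.
  by rewrite -rlmulA e_disj 1?eq_sym// rl_mulx0 le0x.
rewrite rl_residuation rlmulC; exact: (joins_sup (fun j => a j \odot e j)).
Qed.

Lemma decomp_isomorphic :
  rl_isomorphic A (rlproduct (fun i => rlquotient (upset_rlfilter i))).
Proof.
exists decomp; split; last exact: decomp_bij.
- by move=> x y; apply: functional_extensionality_dep => i; exact: qmulE.
- by move=> x y; apply: functional_extensionality_dep => i; exact: qimpE.
Qed.

End BooleanDecomposition.

(** The complemented elements attached to the finitely many maximal filters form
    a partition of unity. *)
Lemma maximal_local_decomposition : is_maximal A -> filter_BLP (Rad A) ->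
  exists (n : nat) (B : 'I_n -> residuatedLatticeType d),
    (forall i, is_local (B i) /\ is_maximal (B i)) /\
    rl_isomorphic A (rlproduct B).
Proof.
move=> Amax RadBLP.
have /finite_seqP[s0 s0P] := finite_maximal_filter Amax.
pose s := undup s0; have s_uniq : uniq s := undup_uniq s0.
have sP M : maximal_filter M <-> M \in s.
  by rewrite mem_undup; change (maximal_filter M <-> [set` s0] M); rewrite -s0P.
pose m (i : 'I_(size s)) : set A := tnth (in_tuple s) i.
have m_max i : maximal_filter (m i) by apply/sP; exact: mem_tnth.
have m_inj : injective m by exact/tuple_uniqP.
have m_surj M : maximal_filter M -> exists i, M = m i.
  by move/sP/(tnthP (in_tuple s)) => [i ->]; exists i.
have [e eP] := choice (fun i => boolean_avoid Amax RadBLP (m_max i)).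
have e_bool i : boolean_center A (e i) by case: (eP i).
have m_only i j : m j (e i) -> j = i.
  move=> mji; apply: m_inj; apply: contrapT => ji.
  have [_ _ /(_ _ (m_max j) ji)] := eP i.
  exact: (maximal_filter_neg (m_max j)).
have e_disj i j : i != j -> e i \odot e j = \bot.
  move=> ij; apply/eqP; apply: contraNT ij => eij0.
  have [|M Mmax Meij] := idem_in_maximal _ eij0.
    by rewrite rlmulACA !boolean_idem.
  have [k Mk] := m_surj _ Mmax; have [[[_ _ Mu] _] _] := Mmax.
  rewrite {}Mk in Mu Meij; apply/eqP; transitivity k.
    by symmetry; apply: m_only; exact: Mu (rl_mul_lel _ _) Meij.
  by apply: m_only; exact: Mu (rl_mul_ler _ _) Meij.
have e_cover z : (forall i, e i <= z) -> z = \top.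
  (* P is a filter that contains the complement of every e i, so it lies in
     none of the maximal filters m i and cannot be proper. *)
  move=> ez; pose P : set A := [set x | z `|` x = \top]%O.
  have Pf : is_filter P.
    split.
    - by exists \top; rewrite /P /= joinx1.
    - by move=> x y; exact: rl_join_mul_top.
    - move=> x y xy Px; apply/eqP; rewrite -le1x -[leLHS]Px.
      by rewrite leU2.
  have [P0|P0] := pselect (P \bot); first by rewrite -P0 joinx0.
  have /(proper_filterP Pf)/maximal_filter_exists[M Mmax PM] := P0.
  have [i Mi] := m_surj _ Mmax; have [e' [ee0 ee1]] := e_bool i.
  have Me' : M e'.
    by apply: PM; apply/eqP; rewrite -le1x -ee1 leU2.
  have Me : M (e i) by rewrite Mi; case: (eP i).
  have [Mp _] := Mmax; have [Mf _] := Mp; move/(proper_filterP Mf): Mp; case.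
  by rewrite -ee0; exact: (@filterI _ _ (RLFilter Mf)).
exists (size s), (fun i => rlquotient (upset_rlfilter e_bool i)).
split; last first.
  exact: decomp_isomorphic.
move=> i; have pi_surj (y : rlquotient (upset_rlfilter e_bool i)) :
    exists x, x /c upset_rlfilter e_bool i = y by exists (repr y); rewrite reprK.
have [_ _ _ _ [_ p1]] := @pi_rl_morph _ _ (upset_rlfilter e_bool i).
have kerE x : x /c upset_rlfilter e_bool i = \top <-> e i <= x.
  rewrite -p1; split=> [/pi_eq[_ h]|h].
    by have := h; rewrite /= /upset /= rl_residuation rlmulx1.
  apply/pi_eq; split; first by apply: filter_le; exact: lex1.
  by rewrite /= /upset /= rl_residuation rlmulx1.
split; last exact: is_maximal_image (@pi_rl_morph _ _ _) pi_surj Amax.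
apply: (is_local_image (@pi_rl_morph _ _ _) pi_surj (m_max i)).
- move=> N /m_surj[j ->] kerN; congr m; apply: m_only; apply: kerN.
  by apply/kerE.
- move=> x /kerE; have [[[_ _ mu] _] _] := m_max i.
  by move/mu; apply; case: (eP i).
Qed.

End Decomposition.

Theorem proposition6p28 (d : Order.disp_t) (A : residuatedLatticeType d) :
  [<-> is_maximal A /\ BLP A;
       is_maximal A /\ filter_BLP (Rad A);
       exists (n : nat) (B : 'I_n -> residuatedLatticeType d),
         (forall i, is_local (B i) /\ is_maximal (B i)) /\
         rl_isomorphic A (rlproduct B)].
Proof.
tfae.
- by move=> [Amax AB]; split=> //; exact: AB.
- by move=> [Amax RadB]; exact: maximal_local_decomposition.
- move=> [n [B [BP [f [fM fi fbij]]]]].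
  have fm := isomorphism_morphism fM fi fbij.
  split; first by apply: is_maximal_product fm fbij _ => i; case: (BP i).
  by apply: BLP_local_product fm fbij _ => i; case: (BP i).
Qed.
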